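(* Let $1<p<\infty$ and let $G$ be a countable group. Assume $K<G$ is an infinite subgroup with $H^1(K,\lambda_{\ell^pK})=\{0\}$. Then either $H^1(G,\lambda_{\ell^pG})=0$ or there is an almost-malnormal subgroup $H\lneq G$ such that $K<H$. In particular, if $K$ is wq-normal in $G$, then $H^1(G,\lambda_{\ell^pG})=0$.
   Context: $\lambda_{\ell^pG}$ is the left-regular representation of $G$ on $\ell^pG$. For a linear representation $\pi$ of $G$ on $V$, a cocycle is a map $b:G\to V$ with $b(gh)=b(g)+\pi(g)b(h)$; coboundaries are the cocycles $g\mapsto\pi(g)\xi-\xi$; $H^1(G,\pi)$ is the quotient of cocycles by coboundaries (unreduced cohomology). A subgroup $M<G$ is almost-malnormal if $M\cap gMg^{-1}$ is finite for every $g\in G\setminus M$. A subgroup $L<G$ is q-normal in $G$ if there is a generating set $A$ of $G$ such that $gLg^{-1}\cap L$ is infinite for all $g\in A$. A subgroup $K<G$ is wq-normal if there are an ordinal $\alpha$ and an increasing chain of subgroups $(H_\beta)_{\beta\le\alpha}$ with $H_0=K$, $H_\alpha=G$, and $\bigcup_{\beta<\gamma}H_\beta$ q-normal in $H_\gamma$ for all $0<\gamma\le\alpha$. *)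

(* Defs.v *)
From HB Require Import structures.
From mathcomp Require Import all_boot all_order all_algebra.
From mathcomp Require Import all_classical all_reals all_analysis.
From mathcomp Require Import ring_quotient complex.

Set Implicit Arguments.
Unset Strict Implicit.
Unset Printing Implicit Defensive.

Import Order.TTheory GRing.Theory Num.Theory.

Local Open Scope classical_set_scope.
Local Open Scope ring_scope.

Section Subgroups.
Variable G : groupType.
Implicit Types (L M A : set G) (K : groupClosed G).

Definition conj_set (g : G) L : set G := [set (g * x * g^-1)%g | x in L].

Definition is_subgroup L : Prop := group_closed (mem L).

Definition generates A L : Prop := smallest is_subgroup A = L.

Definition almost_malnormal K : Prop :=
  forall g : G, g \notin K -> finite_set ([set` K] `&` conj_set g [set` K]).

Definition q_normal L M : Prop :=
  [/\ is_subgroup L, is_subgroup M, L `<=` M &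
      exists2 A, generates A M &
        forall g, A g -> infinite_set (conj_set g L `&` L)].

(* Ordinals beta <= alpha are encoded as the elements of a well-ordered type  *)
(* with a greatest element: \bot stands for 0 and \top for alpha (so that     *)
(* \bot = \top when alpha = 0).                                               *)
Definition wq_normal K : Prop :=
  exists (d : Order.disp_t) (I : tbOrderType d) (H : I -> groupClosed G),
    [/\ well_founded (fun b c : I => (b < c)%O),
        (forall b c : I, (b <= c)%O -> [set` H b] `<=` [set` H c]),
        [set` H \bot%O] = [set` K],
        [set` H \top%O] = [set: G] &
        forall c : I, (\bot < c)%O ->
          q_normal (\bigcup_(b in [set b : I | (b < c)%O]) [set` H b])
                   [set` H c]].

Definition subgroup_type K : Type := {x : G | x \in K}.

Section SubgroupType.
Variable K : groupClosed G.

Lemma groupClosedP : group_closed (fun x : G => x \in K).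
Proof. by split; [exact: gpred1 | move=> x y; exact: gpredF]. Qed.

HB.instance Definition _ :=
  [isSub of subgroup_type K for @sval G (fun x => x \in K)].
HB.instance Definition _ := [Choice of subgroup_type K by <:].
HB.instance Definition _ :=
  SubChoice_isSubGroup.Build G (fun x => x \in K) (subgroup_type K)
    groupClosedP.

End SubgroupType.
End Subgroups.

Record linear_rep (F : pzRingType) (G : groupType) (V : lmodType F) :=
  LinearRep {
  rep :> G -> {linear V -> V};
  rep1 : forall v, rep 1%g v = v;
  repM : forall g h v, rep (g * h)%g v = rep g (rep h v)
}.

Section Cohomology.
Variables (F : pzRingType) (G : groupType) (V : lmodType F).
Variable pi : linear_rep G V.

Definition cocycle : {pred G -> V} :=
  fun b => `[< forall g h, b (g * h)%g = b g + pi g (b h) >].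

Lemma cocycle_zmod_closed : zmod_closed cocycle.
Proof.
split=> [|b c /asboolP hb /asboolP hc]; apply/asboolP => g h.
  by rewrite /GRing.zero /= linear0 addr0.
rewrite -[LHS]/(b (g * h)%g - c (g * h)%g) hb hc.
by rewrite -[(b - c) h]/(b h - c h) linearB opprD addrACA.
Qed.

HB.instance Definition _ :=
  GRing.isZmodClosed.Build (G -> V) cocycle cocycle_zmod_closed.

Definition Z1 : Type := {b : G -> V | cocycle b}.
HB.instance Definition _ := [isSub of Z1 for @sval (G -> V) cocycle].
HB.instance Definition _ := [Choice of Z1 by <:].
HB.instance Definition _ := [SubChoice_isSubZmodule of Z1 by <:].

Definition B1 : {pred Z1} :=
  fun b => `[< exists xi : V, forall g, val b g = pi g xi - xi >].

Lemma B1_zmod_closed : zmod_closed B1.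
Proof.
split=> [|b c /asboolP[x hx] /asboolP[y hy]]; apply/asboolP.
  by exists 0 => g; rewrite raddf0 linear0 subr0.
exists (x - y) => g; rewrite raddfB -[LHS]/(val b g - val c g) hx hy.
by rewrite [in RHS]linearB !opprB [LHS]addrACA [RHS]addrACA [- x + _]addrC.
Qed.

HB.instance Definition _ := GRing.isZmodClosed.Build Z1 B1 B1_zmod_closed.

Definition H1 : zmodType := Quotient.quot B1.

Definition H1_zero : Prop := forall x : H1, x = 0.

End Cohomology.

Arguments B1 {F G V} pi.

Section Lp.
Variable R : realType.

Local Notation normc := (@ComplexField.Normc.normc R).

Lemma normc_ge0 (z : R[i]) : 0 <= normc z.
Proof. by case: z => a b; exact: sqrtr_ge0. Qed.

Section Space.
Variables (p : R) (T : choiceType).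

Definition p_summable : {pred T -> R[i]^o} :=
  fun f => `[< (\esum_(x in [set: T]) (normc (f x) `^ p)%:E < +oo)%E >].

Lemma p_summable_submod_closed : 1 < p -> submod_closed p_summable.
Proof.
move=> p1.
have p0 : 0 <= p by rewrite ltW// (lt_trans _ p1).
have e0 (f : T -> R[i]^o) x : (0 <= (normc (f x) `^ p)%:E)%E.
  by rewrite lee_fin powR_ge0.
split=> [|c f g /asboolP hf /asboolP hg]; apply/asboolP.
  rewrite esum1 ?ltry// => x _.
  by rewrite ComplexField.Normc.normc0 powR0// gt_eqF// (lt_trans _ p1).
set S := (\esum_(x in [set: T]) (normc (f x) `^ p)%:E)%E in hf *.
set S' := (\esum_(x in [set: T]) (normc (g x) `^ p)%:E)%E in hg *.
set A := ((2 * normc c) `^ p)%:E; set B : \bar R := (2 `^ p)%:E.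
apply: (@le_lt_trans _ _ (A * S + B * S')%E); last first.
  have SF : S \is a fin_num by rewrite ge0_fin_numE// esum_ge0.
  have S'F : S' \is a fin_num by rewrite ge0_fin_numE// esum_ge0.
  by rewrite -(fineK SF) -(fineK S'F) ltry.
apply: ub_ereal_sup => _ [X [finX _] <-].
apply: (@le_trans _ _ (\sum_(x \in X)
  (A * (normc (f x) `^ p)%:E + B * (normc (g x) `^ p)%:E))%E).
  apply: lee_fsum => // x _.
  rewrite -!EFinM -EFinD lee_fin -!powRM ?mulr_ge0 ?normc_ge0//.
  rewrite -[X in normc X]/(c * f x + g x).
  have : normc (c * f x + g x) <= normc c * normc (f x) + normc (g x).
    by rewrite -ComplexField.Normc.normcM; exact: le_normcD.
  have := normc_ge0 (c * f x + g x).
  have a0 : 0 <= normc c * normc (f x) by rewrite mulr_ge0 ?normc_ge0.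
  have b0 := normc_ge0 (g x).
  rewrite -mulrA.
  move: (normc c * _) (normc (g x)) (normc (_ + _)) a0 b0 => a b s a0 b0 s0 sab.
  have [ab|/ltW ba] := leP a b.
    rewrite (@le_trans _ _ ((2 * b) `^ p))// ?lerDr ?powR_ge0//.
    by rewrite ge0_ler_powR ?nnegrE ?mulr_ge0// (le_trans sab)//
      mulr_natl mulr2n lerD2r.
  rewrite (@le_trans _ _ ((2 * a) `^ p))// ?lerDl ?powR_ge0//.
  by rewrite ge0_ler_powR ?nnegrE ?mulr_ge0// (le_trans sab)//
      mulr_natl mulr2n lerD2l.
rewrite fsbig_split//= -!ge0_mule_fsumr//.
by apply: leeD; apply: lee_wpmul2l; rewrite ?lee_fin ?powR_ge0//;
  apply: ereal_sup_ubound; exists X.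
Qed.

(* The exponent hypothesis is an argument of the type so that its module      *)
(* structure can be inferred.                                                 *)
Definition lp of 1 < p : Type := {f : T -> R[i]^o | p_summable f}.

Variable p1 : 1 < p.
HB.instance Definition _ :=
  [isSub of lp p1 for @sval (T -> R[i]^o) p_summable].
HB.instance Definition _ := [Choice of lp p1 by <:].
HB.instance Definition _ :=
  GRing.SubChoice_isSubLmodule.Build R[i] (T -> R[i]^o) p_summable (lp p1)
    (p_summable_submod_closed p1).

End Space.

Section LeftRegular.
Variables (p : R) (p1 : 1 < p) (G : groupType).

Lemma p_summable_translate (g : G) (f : G -> R[i]^o) :
  p_summable p f -> p_summable p (fun x => f (g^-1 * x)%g).
Proof.
move=> /asboolP hf; apply/asboolP.
rewrite -(@reindex_esum _ _ _ [set: G] [set: G] (fun x => (g^-1 * x)%g)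
  (fun x => (normc (f x) `^ p)%:E))//.
split=> [//|x y _ _|x _]; first exact: mulgI.
by exists (g * x)%g => //; rewrite mulKg.
Qed.

Definition translate (g : G) (f : lp G p1) : lp G p1 :=
  Sub (fun x => val f (g^-1 * x)%g) (p_summable_translate g (valP f)).

Lemma translate_is_linear g : linear (translate g).
Proof. by move=> c f h; apply/val_inj. Qed.

HB.instance Definition _ g :=
  GRing.isLinear.Build R[i] (lp G p1) (lp G p1) _ (translate g)
    (translate_is_linear g).

Lemma translate1 f : translate 1%g f = f.
Proof. by apply/val_inj/funext => x /=; rewrite invg1 mul1g. Qed.

Lemma translateM g h f : translate (g * h)%g f = translate g (translate h f).
Proof. by apply/val_inj/funext => x /=; rewrite invgM mulgA. Qed.

Definition left_regular : linear_rep G (lp G p1) :=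
  LinearRep translate1 translateM.

End LeftRegular.
End Lp.

(* Main.v *)
From HB Require Import structures.
Require Import Defs.
From mathcomp Require Import all_boot all_order all_algebra.
From mathcomp Require Import all_classical all_reals all_analysis.
From mathcomp Require Import ring_quotient complex finmap ring.

(* A cocycle b with values in functions on G has the form b(g) = gf - f, with *)
(* f(x) = b(x^-1)(1). Restricted to K, the representation l^p(G) is a         *)
(* countable l^p-sum of copies of l^p(K), so on each coset f is, up to a      *)
(* constant, an l^p function xi_n. If the xi_n were not jointly p-summable,   *)
(* then large finite pieces of them, right-translated to be pairwise disjoint *)
(* in K, would add up to one function F on K with kF - F in l^p(K) and F not  *)
(* in l^p(K) + constants, contradicting H^1(K, l^p(K)) = 0.                   *)
(* So one may assume b = 0 on K. Let H be the subgroup {b = 0}. For every g,  *)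
(* b(g) is invariant under H `&` gHg^-1; an l^p function invariant under an   *)
(* infinite subgroup is 0, so H is almost malnormal. The same remark climbs   *)
(* a wq-normal chain by well-founded induction.                               *)

Set Implicit Arguments.
Unset Strict Implicit.
Unset Printing Implicit Defensive.

Import Order.TTheory GRing.Theory Num.Theory.

Local Open Scope classical_set_scope.
Local Open Scope ring_scope.
Local Open Scope quotient_scope.

(** [H1_zero_copies] extends the vanishing over [K] to countably many copies at once, and
    [H1_zero_restrict] transfers it to [G], so cocycles may be taken zero on [K]. Then
    [cocycle_eq0_conj] gives both conclusions. *)

(** * Cocycles and coboundaries *)

Lemma H1_zeroP (F : pzRingType) (G : groupType) (V : lmodType F)
    (pi : linear_rep G V) :
  H1_zero pi <->
  forall b : G -> V, (forall g h, b (g * h)%g = b g + pi g (b h)) ->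
    exists xi, forall g, b g = pi g xi - xi.
Proof.
split=> [pi0 b hb|h x].
  have bZ : cocycle pi b by apply/asboolP.
  pose c : Z1 pi := Sub b bZ.
  have : c \in B1 pi.
    rewrite -[c]subr0 Quotient.idealrBE; apply/eqP.
    by rewrite [LHS]pi0 [RHS]pi0.
  by rewrite unfold_in => /asboolP[xi hxi]; exists xi.
rewrite -[x]reprK; set c := repr x.
have [xi hxi] := h (val c) (asboolW (valP c)).
have cB : c \in B1 pi by rewrite unfold_in; apply/asboolP; exists xi.
have -> : 0 = \pi_(Quotient.quot (B1 pi)) (0 : Z1 pi) by rewrite raddf0.
by apply/eqP; rewrite -Quotient.idealrBE subr0.
Qed.

Section Cocycles.
Variables (F : pzRingType) (G : groupType) (V : lmodType F).
Variables (pi : linear_rep G V) (b : G -> V).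
Hypothesis hb : forall g h, b (g * h)%g = b g + pi g (b h).

Lemma cocycle1 : b 1%g = 0.
Proof.
by apply: (addrI (b 1%g)); rewrite -{2}(rep1 pi (b 1%g)) -hb mul1g addr0.
Qed.

Lemma cocycle_zero_group_closed : group_closed (fun g => `[< b g = 0 >]).
Proof.
split=> [|g h /asboolP bg /asboolP bh]; apply/asboolP; first exact: cocycle1.
rewrite hb bg add0r.
have := hb h^-1%g h; rewrite mulVg cocycle1 bh linear0 addr0 => <-.
exact: linear0.
Qed.

End Cocycles.

(** * p-summable functions *)

Section Summability.
Variables (R : realType) (p : R) (p1 : 1 < p).
Local Notation normc := (@ComplexField.Normc.normc R).

Let p0 : 0 < p. Proof. exact: lt_trans p1. Qed.

Lemma p_summable_dom (S T : choiceType) (D : set S) (e : S -> T)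
    (f : T -> R[i]^o) (g : S -> R[i]^o) :
  set_inj D e -> (forall x, D x -> g x = f (e x)) ->
  (forall x, ~ D x -> g x = 0) -> p_summable p f -> p_summable p g.
Proof.
move=> einj gf g0 /asboolP hf; apply/asboolP; apply: le_lt_trans hf.
rewrite (esumID D) ?setTI; last by move=> i _; rewrite lee_fin powR_ge0.
rewrite [X in (_ + X)%E]esum1 ?adde0; last first.
  move=> x /g0 ->.
  by rewrite ComplexField.Normc.normc0 powR0 ?gt_eqF.
under eq_esum do rewrite gf//.
rewrite -(esum_image D e (fun y => (normc (f y) `^ p)%:E))//.
rewrite [leRHS](esumID (e @` D)) ?setTI; last first.
  by move=> i _; rewrite lee_fin powR_ge0.
by rewrite leeDl// esum_ge0// => i _; rewrite lee_fin powR_ge0.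
Qed.

Lemma p_summable_inj (S T : choiceType) (e : S -> T) (f : T -> R[i]^o) :
  injective e -> p_summable p f -> p_summable p (fun x => f (e x)).
Proof.
move=> einj; apply: (p_summable_dom (D := setT)) => //.
- by move=> x y _ _ /einj.
- by move=> x /(_ I).
Qed.

Lemma p_summableD (T : choiceType) (f g : T -> R[i]^o) :
  p_summable p f -> p_summable p g -> p_summable p (fun x => f x + g x).
Proof.
move=> hf hg; rewrite [X in p_summable p X](_ : _ = 1 *: f + g).
  exact: (p_summable_submod_closed T p1).2.
by rewrite scale1r.
Qed.

Lemma p_summableB (T : choiceType) (f g : T -> R[i]^o) :
  p_summable p f -> p_summable p g -> p_summable p (fun x => f x - g x).
Proof.
move=> hf hg; rewrite [X in p_summable p X](_ : _ = (-1) *: g + f).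
  exact: (p_summable_submod_closed T p1).2.
by rewrite scaleN1r addrC.
Qed.

(** If [c] were nonzero, [n] points of [A] would contribute [n] times |c|^p, which exceeds any
    bound. *)
Lemma p_summable_cst_infinite (T : choiceType) (f : T -> R[i]^o) (A : set T)
    (c : R[i]^o) :
  infinite_set A -> (forall x, A x -> f x = c) -> p_summable p f -> c = 0.
Proof.
move=> Ainf fc /asboolP hf.
apply/eqP/negP => /negP c0.
have a0 : 0 < normc c `^ p.
  rewrite powR_gt0// lt_neqAle normc_ge0 andbT eq_sym.
  by apply: contra c0 => /eqP/ComplexField.Normc.eq0_normc ->.
move: hf; apply/negP; rewrite -leNgt leye_eq; apply/eqP/eq_infty => r.
have [n rn] : exists n : nat, r <= n%:R * normc c `^ p.
  exists (Num.truncn (`|r| / normc c `^ p)).+1.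
  rewrite -ler_pdivrMr// (le_trans _ (ltW (truncnS_gt _)))//.
  by rewrite ler_pM2r ?invr_gt0// ler_norm.
have [X XA nX] := infinite_set_fset n Ainf.
apply: esum_ge; exists [set` X]; first by split=> //; exact: finite_fset.
rewrite fsbig_finite//= set_fsetK.
rewrite (eq_big_seq (fun=> (normc c `^ p)%:E)); last first.
  by move=> x xX; rewrite fc//; exact: XA.
rewrite sumEFin lee_fin big_const_seq count_predT iter_addr_0 -mulr_natl.
  by rewrite (le_trans rn)// ler_wpM2r ?powR_ge0// ler_nat.
Qed.

(** Some finite subsum comes within [eps] of the finite total; the rest is the tail. *)
Lemma p_summable_tail (T : choiceType) (f : T -> R[i]^o) (eps : R) :
  0 < eps -> p_summable p f ->
  exists s : seq T,
    (\esum_(x in [set x | x \notin s]) (normc (f x) `^ p)%:E <= eps%:E)%E.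
Proof.
move=> eps0 /asboolP hf.
set a := fun x : T => (normc (f x) `^ p)%:E.
have a0 x : (0 <= a x)%E by rewrite lee_fin powR_ge0.
have fin : (\esum_(x in [set: T]) a x)%E \is a fin_num.
  by rewrite ge0_fin_numE// esum_ge0.
have [_ [X [finX _] <-] hX] := ub_ereal_sup_adherent eps0 fin.
exists (fset_set X); rewrite (_ : [set x | _] = ~` X); last first.
  apply/seteqP; split=> x /=; rewrite in_fset_set//.
    by move=> /negP; rewrite in_setE.
  by move=> Xx; apply/negP; rewrite in_setE.
have {}hX : (\esum_(x in [set: T]) a x - eps%:E < \sum_(x \in X) a x)%E := hX.
move: fin hX; rewrite (esumID X [set: T] a (fun x _ => a0 x)) !setTI.
have -> : (\esum_(i in X) a i = \sum_(i \in X) a i)%E.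
  by rewrite -esum_fset// set_mem_set.
rewrite -/a fin_numD => /andP[/fineK <- /fineK <-].
rewrite -EFinD lte_fin lee_fin ltrBlDr => h.
by move: h; rewrite ltrD2l => /ltW.
Qed.

End Summability.

(** * Countably many copies of one group *)

(** Greedy choice: only the finitely many d^-1 u, with d in [D n] and u in an earlier translate, are
    forbidden for [h n]. *)
Lemma disjoint_translates (G : groupType) (D : nat -> seq G) :
  infinite_set [set: G] ->
  exists h : nat -> G, forall m n a b, a \in D m -> b \in D n ->
    (a * h m = b * h n)%g -> m = n.
Proof.
move=> Ginf.
have pickP (US : seq G * seq G) :
    exists h, forall d, d \in US.2 -> (d * h)%g \notin US.1.
  pose B := [seq (d^-1 * u)%g | d <- US.2, u <- US.1].
  have /infinite_setN0[h [_ hB]] := infinite_setD Ginf (finite_seq B).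
  exists h => d dS; apply: contra_notN hB => dhU.
  by apply/allpairsP; exists (d, (d * h)%g); rewrite mulKg.
have [pick {}pickP] := choice pickP.
(* [U n] lists the translates of the [D m] by [h m] for m < n. *)
pose U := fix U n := if n is n'.+1
  then [seq (d * pick (U n', D n'))%g | d <- D n'] ++ U n' else [::].
pose h n := pick (U n, D n).
exists h.
have lt_false m n a b : (m < n)%N -> a \in D m -> b \in D n ->
    (a * h m = b * h n)%g -> False.
  move=> mn aD bD e; have := pickP (U n, D n) b bD.
  apply/negP/negPn; rewrite /= -/(h n) -e.
  elim: n mn {bD e b} => // n IH; rewrite ltnS leq_eqVlt => /predU1P[<-|/IH].
    rewrite mem_cat; apply/orP; left.
    exact: (map_f (fun d => d * pick (U m, D m))%g).
  by rewrite [U _.+1]/= mem_cat => ->; rewrite orbT.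
move=> m n a b aD bD e; case: (ltngtP m n) => // mn.
- by case: (lt_false _ _ _ _ mn aD bD e).
- by case: (lt_false _ _ _ _ mn bD aD (esym e)).
Qed.

Section Countable_copies.
Variables (R : realType) (p : R) (p1 : 1 < p).
Local Notation normc := (@ComplexField.Normc.normc R).

(** The differences kF - F form an l^p cocycle, so kF - F = k xi - xi for some l^p function xi. Then
    F - xi is invariant, hence constant. *)
Lemma H1_zero_potential (G : groupType) (F : G -> R[i]^o) :
  H1_zero (left_regular p1 G) ->
  (forall k, p_summable p (fun y => F (k^-1 * y)%g - F y)) ->
  exists c, p_summable p (fun y => F y - c).
Proof.
move=> /H1_zeroP H0 hF.
pose b k : lp G p1 := Sub (fun y => F (k^-1 * y)%g - F y) (hF k).
have [g h|xi hxi] := H0 b.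
  apply/val_inj/funext => y /=.
  rewrite -[RHS]/((F (g^-1 * y)%g - F y) +
                 (F (h^-1 * (g^-1 * y))%g - F (g^-1 * y)%g)).
  by rewrite [RHS]addrC addrA subrK invgM mulgA.
exists (F 1%g - val xi 1%g).
rewrite [X in p_summable p X](_ : _ = val xi); first exact: (valP xi).
apply/funext => y; have /(congr1 (fun f : lp G p1 => val f y)) := hxi y.
rewrite -[LHS]/(F (y^-1 * y)%g - F y).
rewrite -[RHS]/(val xi (y^-1 * y)%g - val xi y) mulVg => e.
by rewrite opprB addrA -[X in X - _](addrC (val xi 1%g)) -addrA -opprB e opprB
  addrC subrK.
Qed.

(** The bounds form a geometric series of sum 1. *)
Lemma p_summable_pair (T : choiceType) (f : nat * T -> R[i]^o) :
  (forall n, (\esum_(k in [set: T]) (normc (f (n, k)) `^ p)%:E <=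
    (1 / (2 ^ n.+1)%:R)%:E)%E) -> p_summable p f.
Proof.
move=> hf; apply/asboolP.
rewrite (_ : [set: nat * T] = [set: nat] `*`` (fun=> [set: T])); last first.
  by apply/seteqP; split.
rewrite (eq_esum (b := fun x => (normc (f (x.1, x.2)) `^ p)%:E)); last first.
  by move=> [].
rewrite -(@esum_esum R nat T [set: nat] (fun=> [set: T])
  (fun n k => (normc (f (n, k)) `^ p)%:E)); last first.
  by move=> *; rewrite lee_fin powR_ge0.
apply: le_lt_trans (ltry 1).
apply: le_trans (epsilon_trick0 xpredT (@ler01 R)).
rewrite nneseries_esum ?fun_true; last first.
  by move=> n _; rewrite lee_fin divr_ge0.
by apply: le_esum => n _; exact: hf.
Qed.

Lemma H1_zero_copies (G : groupType) (f : nat * G -> R[i]^o) :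
  infinite_set [set: G] -> H1_zero (left_regular p1 G) ->
  (forall k, p_summable p (fun x => f (x.1, (k^-1 * x.2)%g) - f x)) ->
  exists c : nat -> R[i]^o, p_summable p (fun x => f x - c x.1).
Proof.
move=> Ginf G0 hf.
(* Each copy separately gives its constant; joint summability is what remains. *)
have /choice[c hc] n : exists c, p_summable p (fun y => f (n, y) - c).
  apply: H1_zero_potential G0 _ => k.
  by apply: (p_summable_inj p1 (e := pair n) _ (hf k)) => x y [].
exists c; set xi := (fun x => _).
(* All but a p-summable part of xi is carried by the finite sets D n. *)
have /choice[D hD] n : exists s : seq G,
    (\esum_(x in [set x | x \notin s])
      (normc (xi (n, x)) `^ p)%:E <=
     (1 / (2 ^ n.+1)%:R)%:E)%E.
  by apply: p_summable_tail (hc n); rewrite divr_gt0// ltr0n expn_gt0.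
pose xi1 x := if x.2 \in D x.1 then xi x else 0.
have hxi2 : p_summable p (fun x => xi x - xi1 x).
  apply: p_summable_pair => n; apply: le_trans (hD n).
  rewrite [leRHS]esum_mkcond; apply: le_esum => x _; rewrite /xi1/=.
  case: ifPn => xD; rewrite ?subrr ?subr0.
    rewrite ComplexField.Normc.normc0 powR0 ?gt_eqF ?(lt_trans _ p1)//.
    by case: ifP => // _; rewrite lee_fin powR_ge0.
  by rewrite mem_set.
suff hxi1 : p_summable p xi1.
  rewrite [X in p_summable p X](_ : _ = fun x => xi1 x + (xi x - xi1 x)).
    exact: p_summableD.
  by apply/funext => x; rewrite addrC subrK.
(* Translation by [k] preserves the copy, so the constants [c] cancel in these differences. *)
pose w k x := xi1 (x.1, (k^-1 * x.2)%g) - xi1 x.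
have hw k : p_summable p (w k).
  pose t x := xi (x.1, (k^-1 * x.2)%g) - xi1 (x.1, (k^-1 * x.2)%g).
  have ht : p_summable p t.
    apply: (p_summable_inj p1 (e := fun x => (x.1, (k^-1 * x.2)%g)) _ hxi2).
    by move=> [m a] [n b] /= [-> /mulgI ->].
  have := p_summableB p1 (hf k) (p_summableB p1 ht hxi2).
  congr (p_summable p _); apply/funext => x; rewrite /w/t/xi/=.
  set a := f _; set b := f x; set u := xi1 _; set v := xi1 x; set r := c _.
  by ring.
(* The translates of the extra points z n are zeros of the function F below. *)
have /choice[z hz] n : exists z, z \notin D n.
  have /infinite_setN0[z [_ /= /negP]] := infinite_setD Ginf (finite_seq (D n)).
  by exists z.
have [h hh] := disjoint_translates (fun n => z n :: D n) Ginf.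
(* [N y] is the index of the unique translate containing [y], and arbitrary if there is none. *)
have /choice[N hN] y : exists n, forall m a, a \in z m :: D m ->
    y = (a * h m)%g -> n = m.
  have [[n [a [aD ->]]]|no] :=
      pselect (exists n a, a \in z n :: D n /\ y = (a * h n)%g).
    by exists n => m b bD; exact: hh.
  by exists 0%N => m a aD ya; case: no; exists m, a.
pose psi y := (N y, y * (h (N y))^-1)%g.
have psiK y : ((psi y).2 * h (psi y).1)%g = y by rewrite mulgVK.
have xi1_0 n y : N y <> n -> xi1 (n, y * (h n)^-1)%g = 0.
  move=> Nyn; rewrite /xi1/=; case: ifPn => // yD; case: Nyn.
  apply: (hN _ _ (y * (h n)^-1)%g); first by rewrite in_cons yD orbT.
  by rewrite mulgVK.
(* F is the sum over n of the right translates by h n of xi1 (n, _); at each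
   point at most one term is nonzero, hence at most two terms contribute to
   each value of kF - F. *)
pose F y := xi1 (psi y).
have [k|c0 hc0] := H1_zero_potential (F := F) G0.
  (* [g1] is the term of index N(y); [g2] is the term of index N(k^-1 y) when the two indices
     differ. *)
  pose g1 y := w k (psi y).
  pose g2 y := if N (k^-1 * y)%g == N y then 0
    else w k ((psi (k^-1 * y)%g).1, (k * (psi (k^-1 * y)%g).2)%g).
  rewrite [X in p_summable p X](_ : _ = fun y => g1 y + g2 y).
    apply: p_summableD => //.
      apply: (p_summable_inj p1 (e := psi) _ (hw k)) => x y e.
      by rewrite -(psiK x) e psiK.
    apply: (p_summable_dom p1 (D := [set y | N (k^-1 * y)%g != N y])
      (e := fun y => ((psi (k^-1 * y)%g).1, (k * (psi (k^-1 * y)%g).2)%g))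
      _ _ _ (hw k)).
    - move=> x y _ _ [e1 /mulgI e2].
      have e : psi (k^-1 * x)%g = psi (k^-1 * y)%g by congr (_, _).
      by apply: (mulgI k^-1%g); rewrite -(psiK (k^-1 * x)%g) e psiK.
    - by move=> y /= /negbTE; rewrite /g2 => ->.
    - by move=> y /= /negP/negPn; rewrite /g2 => ->.
  apply/funext => y; rewrite /F/g1/g2/w/=.
  case: eqP => [e|ne]; first by rewrite addr0 /psi/= e mulgA.
  have -> : xi1 (N y, k^-1 * (y * (h (N y))^-1))%g = 0.
    by rewrite mulgA; exact: xi1_0.
  set N' := N (k^-1 * y)%g in ne *.
  have -> : xi1 (N', k * (k^-1 * y * (h N')^-1))%g = 0.
    by rewrite !mulgA mulgV mul1g; apply: xi1_0; exact: nesym.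
  by rewrite mulKg sub0r subr0 addrC.
(* [F] vanishes at the infinitely many points [z n * h n]. *)
have c00 : - c0 = 0.
  apply: (p_summable_cst_infinite (A := range (fun n => z n * h n)%g)
    _ _ hc0).
    rewrite (eq_finite_set (inj_card_eq _)); first exact: infinite_nat.
    by move=> m n _ _; apply: hh; rewrite mem_head.
  move=> _ [n _ <-]; rewrite /F/psi.
  have -> : N (z n * h n)%g = n by apply: (hN _ _ (z n)); rewrite ?mem_head.
  by rewrite mulgK /xi1/= (negbTE (hz n)) sub0r.
apply: (p_summable_dom p1 (D := [set x | x.2 \in D x.1])
  (e := fun x => (x.2 * h x.1)%g) _ _ _ hc0).
- move=> [m a] [n b] /set_mem/= aD /set_mem/= bD e.
  have mn : m = n by apply: (hh m n a b) => //; rewrite in_cons ?aD ?bD orbT.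
  by move: e; rewrite mn => /mulIg ->.
- move=> [n a] /= aD; rewrite c00 addr0 /F/psi.
  have -> : N (a * h n)%g = n by apply: (hN _ _ a); rewrite ?in_cons ?aD ?orbT.
  by rewrite mulgK.
- by move=> x /negP/negbTE; rewrite /xi1 => ->.
Qed.

End Countable_copies.

(** * From the subgroup to the whole group *)

(** For each x, such a [v] is constant on the infinite set of all g^-1 x with g in [M]. *)
Lemma lp_invariant_eq0 (R : realType) (p : R) (p1 : 1 < p) (G : groupType)
    (M : set G) (v : lp G p1) :
  infinite_set M -> (forall g, M g -> left_regular p1 G g v = v) -> v = 0.
Proof.
move=> Minf Mv; apply/val_inj/funext => x; rewrite -[RHS]/(0 : R[i]^o).
apply: (p_summable_cst_infinite (A := (fun g => (g^-1 * x)%g) @` M)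
  _ _ (valP v)).
  rewrite (eq_finite_set (inj_card_eq _))// => g h _ _ /mulIg.
  exact: invg_inj.
by move=> _ [g /Mv e <-]; rewrite -[in RHS]e.
Qed.

(* [G] embeds [K]-equivariantly in [nat * K], the first component numbering the
   right cosets of [K]. *)
Lemma subgroup_coordinates (G : groupType) (K : groupClosed G) :
  countable [set: G] ->
  exists e : G -> nat * subgroup_type K, injective e /\
    forall (k : subgroup_type K) x,
      e (val k * x)%g = ((e x).1, (k * (e x).2)%g).
Proof.
move=> /countable_injP[iota iotaI].
pose coset (x : G) : set G := [set y | (y * x^-1)%g \in K].
(* The representative is chosen from the coset as a set, so it is the same for all elements of the
   coset. *)
pose r x := xget 1%g (coset x).
have rx x : (r x * x^-1)%g \in K.
  rewrite /r; case: xgetP => [y -> //|/(_ x)[]].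
  by rewrite /coset/= mulgV gpred1.
have kx x : (x * (r x)^-1)%g \in K by rewrite -gpredV invgM invgK.
exists (fun x => (iota (r x), Sub (x * (r x)^-1)%g (kx x))); split.
  move=> x y [e1 e2]; move: e2; rewrite (iotaI (r x) (r y) _ _ e1) ?in_setT//.
  exact: mulIg.
move=> k x; have rkx : r (val k * x)%g = r x.
  congr (xget _ _); apply/funext => y; rewrite /coset/= invgM mulgA.
  by rewrite gpredFr//; exact: (valP k).
congr (_, _); first by rewrite rkx.
by apply/val_inj; rewrite valM /= rkx mulgA.
Qed.

Lemma infinite_subgroup_type (G : groupType) (K : groupClosed G) :
  infinite_set [set` K] -> infinite_set [set: subgroup_type K].
Proof.
apply: contra_not => /(finite_image (@sval G (fun x => x \in K))).
apply: sub_finite_set => x xK; by exists (exist _ x xK).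
Qed.

Section Restriction.
Variables (R : realType) (p : R) (p1 : 1 < p) (G : groupType).
Local Notation pi := (left_regular p1 G).

Lemma cocycle_potential (b : G -> lp G p1) :
  (forall g h, b (g * h)%g = b g + pi g (b h)) ->
  exists f : G -> R[i]^o, forall g x, val (b g) x = f (g^-1 * x)%g - f x.
Proof.
move=> hb; exists (fun x => val (b x^-1%g) 1%g) => g x.
rewrite invgM invgK hb -[X in X - _]/(val (b x^-1%g) 1%g +
  val (b g) (x^-1^-1 * 1)%g).
by rewrite addrC addKr mulg1 invgK.
Qed.

Lemma H1_zero_restrict (K : groupClosed G) (b : G -> lp G p1) :
  countable [set: G] -> infinite_set [set` K] ->
  H1_zero (left_regular p1 (subgroup_type K)) ->
  (forall g h, b (g * h)%g = b g + pi g (b h)) ->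
  exists xi, forall g, g \in K -> b g = pi g xi - xi.
Proof.
move=> Gcount Kinf K0 /cocycle_potential[f hf].
have [e [einj eM]] := subgroup_coordinates K Gcount.
have /choice[e' he'] u : exists y, forall x, e x = u -> y = x.
  have [[x xu]|no] := pselect (exists x, e x = u).
    by exists x => y; rewrite -xu => /einj.
  by exists 1%g => x xu; case: no; exists x.
(* The range of [e] is stable under [K], so extension by 0 keeps the differences p-summable. *)
pose ft u : R[i]^o := if `[< range e u >] then f (e' u) else 0.
have fte x : ft (e x) = f x.
  by rewrite /ft asboolT; [rewrite (he' _ x)|exists x].
have [k|c hc] := H1_zero_copies (f := ft) (infinite_subgroup_type Kinf) K0.
  apply: (p_summable_dom p1 (D := range e) (e := e') _ _ _ (valP (b (val k)))).
  - move=> _ _ /set_mem[x _ <-] /set_mem[y _ <-].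
    by rewrite !(he' _ _ erefl) => ->.
  - by move=> _ [x _ <-]; rewrite -eM !fte (he' _ x)// hf.
  - move=> u uN; rewrite /ft !asboolF ?subrr// => -[x _ xu].
    apply: uN; exists (val k * x)%g => //.
    by rewrite eM xu /= mulVKg -surjective_pairing.
pose xi : lp G p1 := Sub (fun x => ft (e x) - c (e x).1)
  (p_summable_inj p1 einj hc).
exists xi => k kK; apply/val_inj/funext => x.
rewrite hf -[RHS]/((ft (e (k^-1 * x)%g) - c (e (k^-1 * x)%g).1)
                   - (ft (e x) - c (e x).1)).
have -> : (e (k^-1 * x)%g).1 = (e x).1.
  have kVK : (k^-1)%g \in K by rewrite gpredV.
  exact: (congr1 fst (eM (Sub (k^-1)%g kVK) x)).
by rewrite !fte opprB addrA subrK.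
Qed.

(** If h = g l g^-1 with h and l in [L], expanding b(hg) = b(gl) gives h b(g) = b(g). *)
Lemma cocycle_eq0_conj (b : G -> lp G p1) (L : set G) (g : G) :
  (forall g h, b (g * h)%g = b g + pi g (b h)) -> L `<=` [set g | b g = 0] ->
  infinite_set (conj_set g L `&` L) -> b g = 0.
Proof.
move=> hb bL Linf; apply: (lp_invariant_eq0 Linf) => h [[l Ll lh] Lh].
have : b (h * g)%g = b (g * l)%g by rewrite -lh mulgVK.
by rewrite !hb (bL _ Lh) (bL _ Ll) linear0 add0r addr0.
Qed.

End Restriction.

(** * Almost-malnormality and wq-normal chains *)

Lemma groupClosed_of (G : groupType) (S : {pred G}) :
  group_closed S -> exists H : groupClosed G, forall g, (g \in H) = S g.
Proof.
move=> hS.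
pose HV := isInvClosed.Build G S (group_closedV hS).
pose HO := isMul1Closed.Build G S hS.1.
pose HM := isMulClosed.Build G S (group_closedM hS).
pose H : groupClosed G := HB.pack S HV HO HM.
by exists H.
Qed.

Theorem corollary5p11 (R : realType) (p : R) (p1 : 1 < p) (G : groupType)
    (Gcount : countable [set: G]) (K : groupClosed G)
    (Kinf : infinite_set [set` K])
    (HK : H1_zero (left_regular p1 (subgroup_type K))) :
  (H1_zero (left_regular p1 G) \/
   exists H : groupClosed G,
     [/\ almost_malnormal H, [set` H] `<` [set: G] & [set` K] `<=` [set` H]])
  /\ (wq_normal K -> H1_zero (left_regular p1 G)).
Proof.
pose cocycle_on (b : G -> lp G p1) :=
  (forall g h, b (g * h)%g = b g + left_regular p1 G g (b h)) /\
  (forall g, g \in K -> b g = 0).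
have H1P : (forall b, cocycle_on b -> forall g, b g = 0) ->
    H1_zero (left_regular p1 G).
  move=> h; apply/H1_zeroP => b hb.
  have [xi hxi] := H1_zero_restrict Gcount Kinf HK hb.
  exists xi => g; apply/eqP; rewrite -subr_eq0; apply/eqP.
  (* Subtracting the coboundary that agrees with [b] on [K] leaves a cocycle vanishing there. *)
  apply: (h (fun g => b g - (left_regular p1 G g xi - xi))); split=> {}g.
    move=> k; rewrite hb repM linearB /= !linearB /=.
    rewrite [RHS]addrACA; congr (_ + _).
    by rewrite [RHS]addrC addrA subrK.
  by move=> gK; rewrite hxi ?subrr.
split.
  have [|] := pselect (forall b, cocycle_on b -> forall g, b g = 0).
    by left; exact: H1P.
  (* The zero set of a nonzero cocycle vanishing on [K] is the required proper subgroup. *)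
  move=> /existsNP[b /not_implyP[[hb bK] /existsNP[g0 bg0]]]; right.
  have [H HE] := groupClosed_of (cocycle_zero_group_closed hb).
  have inH g : (g \in H) <-> b g = 0.
    by rewrite HE; split=> /asboolP.
  exists H; split.
  - move=> g gH; apply: contrapT => Hinf; case/negP: gH; apply/inH.
    apply: (cocycle_eq0_conj (L := [set` H]) hb) => [h /inH//|].
    by rewrite setIC.
  - by split=> // /(_ g0 I) /inH.
  - by move=> k /bK /inH.
move=> [d [I [H [wf Hmono H0 Htop Hq]]]]; apply: H1P => b [hb bK] g.
suff /(_ \top%O g) : forall c : I, [set` H c] `<=` [set g | b g = 0].
  by rewrite Htop; apply.
move=> c; elim/(well_founded_ind wf): c => c IH.
have [cbot|cbot] := eqVneq c \bot%O.
  by rewrite cbot H0 => h /bK.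
have := Hq c; rewrite lt0x cbot => /(_ isT)[_ _ _ [A AH Ainf]].
(* By induction [b] vanishes on the union of the earlier subgroups, so [cocycle_eq0_conj] kills it
   on the generators [A], hence on the subgroup they generate. *)
rewrite -AH; apply: smallest_sub.
  exact: cocycle_zero_group_closed hb.
move=> a /Ainf; apply: cocycle_eq0_conj hb _.
by move=> h [i /= ic]; exact: IH.
Qed.
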